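(* Let $n>2$ be an integer. The Drinfeld–Kohno Lie algebra $\mathbf L_n$ over $\mathbb Z$ is a free $\mathbb Z$-module, with a $\mathbb Z$-basis given by the (images in $\mathbf L_n$ of the) elements $$\{[t_{ik_1}t_{ik_2}\cdots t_{ik_m}]\ \mid\ t_{ik_1}t_{ik_2}\cdots t_{ik_m}\text{ is an associative Lyndon–Shirshov word in }T^*,\ m\in\mathbb N\},$$ where $T=\{t_{ij}\mid 1\le i<j\le n-1\}$, all letters of each word have the same first index $i$ (with $i$ ranging over all possible values and $i<k_1,\dots,k_m\le n-1$), $m\ge 1$, and $[w]$ denotes the standard Lyndon–Shirshov bracketing of $w$.
   Context: Drinfeld–Kohno Lie algebra. For $n>2$, $\mathbf L_n$ is the Lie algebra over $\mathbb Z$ with generators $t_{ij}=t_{ji}$ for distinct indices $1\le i,j\le n-1$ and relations $[t_{ij},t_{kl}]=0$ and $[t_{ij},t_{ik}+t_{jk}]=0$ for distinct $i,j,k,l$. The set $T=\{t_{ij}\mid 1\le i<j\le n-1\}$ is ordered by $t_{ij}<t_{kl}$ iff $i<k$, or $i=k$ and $j<l$. $T^*$ is the free monoid on $T$. Lex order $\succ$ on $T^*$: $1\succ t$ for every $t\neq1$; and if $u=au'$, $v=bv'$ with $a,b\in T$, then $u\succ v$ iff $a>b$, or $a=b$ and $u'\succ v'$. Deg-lex order $>$ on $T^*$: $u>v$ iff $u$ is longer than $v$, or they have the same length and $u\succ v$. A word $w\in T^*\setminus\{1\}$ is an associative Lyndon–Shirshov word (ALSW) if $w=uv$ with $u,v\neq1$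 implies $w>vu$. The standard bracketing $[w]$ of an ALSW $w$ is defined by $[w]=w$ if $w$ is a single letter, and otherwise $[w]=[[u][v]]$, where $w=uv$ and $v$ is the longest proper suffix of $w$ that is an ALSW. *)

(* Defs.v *)
From HB Require Import structures.
From mathcomp Require Import all_boot all_order all_algebra.
From mathcomp Require Import boolp.

Set Implicit Arguments.
Unset Strict Implicit.
Unset Printing Implicit Defensive.

Import GRing.Theory.
Local Open Scope ring_scope.
Local Open Scope quotient_scope.

(* A Lie algebra over Z is an abelian group with a biadditive alternating
   bracket satisfying the Jacobi identity; Z-bilinearity is biadditivity. *)
HB.mixin Record Zmodule_isLieRing L & GRing.Zmodule L := {
  lie : L -> L -> L;
  lieDl : forall x y z, lie (x + y) z = lie x z + lie y z;
  lieDr : forall x y z, lie x (y + z) = lie x y + lie x z;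
  liexx : forall x, lie x x = 0;
  lie_jacobi : forall x y z,
    lie x (lie y z) + lie y (lie z x) + lie z (lie x y) = 0
}.

#[short(type="lieRingType")]
HB.structure Definition LieRing := {L of GRing.Zmodule L & Zmodule_isLieRing L}.

Record is_lie_morphism (L M : lieRingType) (h : L -> M) : Prop := IsLieMorphism {
  lie_morphD : forall x y, h (x + y) = h x + h y;
  lie_morph_lie : forall x y, h (lie x y) = lie (h x) (h y)
}.

Inductive lie_term (X : Type) : Type :=
| LGen of X
| LZero
| LOpp of lie_term X
| LAdd of lie_term X & lie_term X
| LBr of lie_term X & lie_term X.
Arguments LZero {X}.

HB.instance Definition _ (X : Type) := gen_eqMixin (lie_term X).
HB.instance Definition _ (X : Type) := gen_choiceMixin (lie_term X).

(* The least congruence on terms that contains the relators [R] and whose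
   quotient is a Lie algebra over Z. *)
Inductive lie_cong (X : Type) (R : lie_term X -> lie_term X -> Prop) :
    lie_term X -> lie_term X -> Prop :=
| LC_rel s t : R s t -> lie_cong R s t
| LC_refl s : lie_cong R s s
| LC_sym s t : lie_cong R s t -> lie_cong R t s
| LC_trans s t u : lie_cong R s t -> lie_cong R t u -> lie_cong R s u
| LC_opp s s' : lie_cong R s s' -> lie_cong R (LOpp s) (LOpp s')
| LC_add s s' t t' : lie_cong R s s' -> lie_cong R t t' ->
    lie_cong R (LAdd s t) (LAdd s' t')
| LC_br s s' t t' : lie_cong R s s' -> lie_cong R t t' ->
    lie_cong R (LBr s t) (LBr s' t')
| LC_addA s t u : lie_cong R (LAdd s (LAdd t u)) (LAdd (LAdd s t) u)
| LC_addC s t : lie_cong R (LAdd s t) (LAdd t s)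
| LC_add0 s : lie_cong R (LAdd LZero s) s
| LC_addN s : lie_cong R (LAdd (LOpp s) s) LZero
| LC_brDl s t u : lie_cong R (LBr (LAdd s t) u) (LAdd (LBr s u) (LBr t u))
| LC_brDr s t u : lie_cong R (LBr s (LAdd t u)) (LAdd (LBr s t) (LBr s u))
| LC_brxx s : lie_cong R (LBr s s) LZero
| LC_jacobi s t u : lie_cong R
    (LAdd (LAdd (LBr s (LBr t u)) (LBr t (LBr u s))) (LBr u (LBr s t))) LZero.

Definition lie_congb (X : Type) (R : lie_term X -> lie_term X -> Prop) :
  rel (lie_term X) := fun s t => `[< lie_cong R s t >].

Lemma lie_congb_refl X R : reflexive (@lie_congb X R).
Proof. by move=> s; apply/asboolP; apply: LC_refl. Qed.

Lemma lie_congb_sym X R : symmetric (@lie_congb X R).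
Proof. by move=> s t; apply/asboolP/asboolP; apply: LC_sym. Qed.

Lemma lie_congb_trans X R : transitive (@lie_congb X R).
Proof.
by move=> t s u /asboolP st /asboolP tu; apply/asboolP; apply: LC_trans st tu.
Qed.

Canonical lie_cong_equiv X (R : lie_term X -> lie_term X -> Prop) :=
  EquivRel (lie_congb R) (@lie_congb_refl X R) (@lie_congb_sym X R)
    (@lie_congb_trans X R).

Definition lie_pres (X : Type) (R : lie_term X -> lie_term X -> Prop) : Type :=
  {eq_quot lie_congb R}.

HB.instance Definition _ X (R : lie_term X -> lie_term X -> Prop) :=
  Choice.on (lie_pres R).
HB.instance Definition _ X (R : lie_term X -> lie_term X -> Prop) :=
  EqQuotient.on (lie_pres R).

Definition lie_class X (R : lie_term X -> lie_term X -> Prop)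
  (s : lie_term X) : lie_pres R := \pi_(lie_pres R) s.

Lemma lie_classP X (R : lie_term X -> lie_term X -> Prop) s t :
  lie_class R s = lie_class R t <-> lie_cong R s t.
Proof.
rewrite /lie_class; split=> [/eqP|st].
  by rewrite eqmodE => /asboolP.
by apply/eqP; rewrite eqmodE; apply/asboolP.
Qed.

Lemma lie_class_repr X (R : lie_term X -> lie_term X -> Prop) x :
  lie_class R (repr x) = x.
Proof. exact: reprK. Qed.

Lemma lie_repr_class X (R : lie_term X -> lie_term X -> Prop) s :
  lie_cong R (repr (lie_class R s)) s.
Proof. by apply/lie_classP; rewrite lie_class_repr. Qed.

Definition lp_zero X (R : lie_term X -> lie_term X -> Prop) : lie_pres R :=
  lie_class R LZero.
Definition lp_opp X (R : lie_term X -> lie_term X -> Prop) (x : lie_pres R) :=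
  lie_class R (LOpp (repr x)).
Definition lp_add X (R : lie_term X -> lie_term X -> Prop) (x y : lie_pres R) :=
  lie_class R (LAdd (repr x) (repr y)).
Definition lp_br X (R : lie_term X -> lie_term X -> Prop) (x y : lie_pres R) :=
  lie_class R (LBr (repr x) (repr y)).

Lemma lp_oppE X R s :
  lp_opp (lie_class R s) = lie_class R (LOpp s) :> @lie_pres X R.
Proof. by apply/lie_classP/LC_opp/lie_repr_class. Qed.

Lemma lp_addE X R s t : lp_add (lie_class R s) (lie_class R t)
  = lie_class R (LAdd s t) :> @lie_pres X R.
Proof. by apply/lie_classP/LC_add; apply: lie_repr_class. Qed.

Lemma lp_brE X R s t : lp_br (lie_class R s) (lie_class R t)
  = lie_class R (LBr s t) :> @lie_pres X R.
Proof. by apply/lie_classP/LC_br; apply: lie_repr_class. Qed.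

Lemma lp_addA X R : associative (@lp_add X R).
Proof.
move=> x y z; rewrite -(lie_class_repr x) -(lie_class_repr y).
rewrite -(lie_class_repr z) !lp_addE; exact/lie_classP/LC_addA.
Qed.

Lemma lp_addC X R : commutative (@lp_add X R).
Proof. by move=> x y; apply/lie_classP/LC_addC. Qed.

Lemma lp_add0 X R : left_id (@lp_zero X R) (@lp_add X R).
Proof.
by move=> x; rewrite -(lie_class_repr x) lp_addE; apply/lie_classP/LC_add0.
Qed.

Lemma lp_addN X R : left_inverse (@lp_zero X R) (@lp_opp X R) (@lp_add X R).
Proof.
move=> x; rewrite -(lie_class_repr x) lp_oppE lp_addE.
exact/lie_classP/LC_addN.
Qed.

HB.instance Definition _ X (R : lie_term X -> lie_term X -> Prop) :=
  GRing.isZmodule.Build (lie_pres R) (@lp_addA X R) (@lp_addC X R)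
    (@lp_add0 X R) (@lp_addN X R).

Lemma lp_brDl X R (x y z : @lie_pres X R) :
  lp_br (x + y) z = lp_br x z + lp_br y z.
Proof.
change (lp_br (lp_add x y) z = lp_add (lp_br x z) (lp_br y z)).
rewrite -(lie_class_repr x) -(lie_class_repr y) -(lie_class_repr z).
rewrite !(lp_addE, lp_brE); exact/lie_classP/LC_brDl.
Qed.

Lemma lp_brDr X R (x y z : @lie_pres X R) :
  lp_br x (y + z) = lp_br x y + lp_br x z.
Proof.
change (lp_br x (lp_add y z) = lp_add (lp_br x y) (lp_br x z)).
rewrite -(lie_class_repr x) -(lie_class_repr y) -(lie_class_repr z).
rewrite !(lp_addE, lp_brE); exact/lie_classP/LC_brDr.
Qed.

Lemma lp_brxx X R (x : @lie_pres X R) : lp_br x x = 0.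
Proof. by apply/lie_classP/LC_brxx. Qed.

Lemma lp_jacobi X R (x y z : @lie_pres X R) :
  lp_br x (lp_br y z) + lp_br y (lp_br z x) + lp_br z (lp_br x y) = 0.
Proof.
change (lp_add (lp_add (lp_br x (lp_br y z)) (lp_br y (lp_br z x)))
  (lp_br z (lp_br x y)) = lp_zero R).
rewrite -(lie_class_repr x) -(lie_class_repr y) -(lie_class_repr z).
rewrite !lp_brE !lp_addE; exact/lie_classP/LC_jacobi.
Qed.

HB.instance Definition _ X (R : lie_term X -> lie_term X -> Prop) :=
  Zmodule_isLieRing.Build (lie_pres R) (@lp_brDl X R) (@lp_brDr X R)
    (@lp_brxx X R) (@lp_jacobi X R).

Definition lie_gen X (R : lie_term X -> lie_term X -> Prop) (x : X) :
  lie_pres R := lie_class R (LGen x).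

Fixpoint lie_eval X (L : lieRingType) (f : X -> L) (s : lie_term X) : L :=
  match s with
  | LGen x => f x
  | LZero => 0
  | LOpp s => - lie_eval f s
  | LAdd s t => lie_eval f s + lie_eval f t
  | LBr s t => lie (lie_eval f s) (lie_eval f t)
  end.

Lemma lie_eval_cong X (R : lie_term X -> lie_term X -> Prop)
    (L : lieRingType) (f : X -> L) :
  (forall s t, R s t -> lie_eval f s = lie_eval f t) ->
  forall s t, lie_cong R s t -> lie_eval f s = lie_eval f t.
Proof.
move=> fR s t; elim=> {s t} //=.
- by move=> s t u _ -> _ ->.
- by move=> s s' _ ->.
- by move=> s s' t t' _ -> _ ->.
- by move=> s s' t t' _ -> _ ->.
- by move=> s t u; rewrite addrA.
- by move=> s t; rewrite addrC.
- by move=> s; rewrite add0r.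
- by move=> s; rewrite addNr.
- by move=> s t u; rewrite lieDl.
- by move=> s t u; rewrite lieDr.
- by move=> s; rewrite liexx.
- by move=> s t u; rewrite lie_jacobi.
Qed.

(* [lie_pres R] has the universal property of the presentation <X | R>. *)
Lemma lie_pres_universal X (R : lie_term X -> lie_term X -> Prop)
    (L : lieRingType) (f : X -> L) :
  (forall s t, R s t -> lie_eval f s = lie_eval f t) ->
  exists h : lie_pres R -> L, [/\ is_lie_morphism h,
    forall x, h (lie_gen R x) = f x &
    forall g : lie_pres R -> L, is_lie_morphism g ->
      (forall x, g (lie_gen R x) = f x) -> g =1 h].
Proof.
move=> /lie_eval_cong fR; pose h (x : lie_pres R) := lie_eval f (repr x).
have hE s : h (lie_class R s) = lie_eval f s by apply/fR/lie_repr_class.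
exists h; split; first split.
- move=> x y; rewrite -(lie_class_repr x) -(lie_class_repr y).
  by rewrite [_ + _]lp_addE !hE.
- move=> x y; rewrite -(lie_class_repr x) -(lie_class_repr y).
  by rewrite [lie _ _]lp_brE !hE.
- by move=> x; rewrite hE.
move=> g [gD gB] gf x; rewrite -(lie_class_repr x) hE.
have g0 : g 0 = 0 by apply: (addIr (g 0)); rewrite -gD !add0r.
have gN y : g (- y) = - g y.
  by apply/eqP; rewrite -addr_eq0 -gD addNr g0.
elim: (repr x) => [y||s IHs|s IHs t IHt|s IHs t IHt] /=.
- exact: gf.
- exact: g0.
- by rewrite -lp_oppE gN IHs.
- by rewrite -lp_addE gD IHs IHt.
- by rewrite -lp_brE gB IHs IHt.
Qed.

(* The index set {1, ..., n-1} is represented by 'I_n.-1 = {0, ..., n-2}. *)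
Definition dk_pair (n : nat) := {p : 'I_n.-1 * 'I_n.-1 | p.1 != p.2}.

Definition dk_t (n : nat) (i j : 'I_n.-1) (ij : i != j) : lie_term (dk_pair n) :=
  LGen (exist (fun p : 'I_n.-1 * 'I_n.-1 => p.1 != p.2) (i, j) ij).

Inductive dk_rel (n : nat) : lie_term (dk_pair n) -> lie_term (dk_pair n) -> Prop :=
| DK_sym (i j : 'I_n.-1) (ij : i != j) (ji : j != i) :
    dk_rel (dk_t ij) (dk_t ji)
| DK_comm (i j k l : 'I_n.-1) (ij : i != j) (kl : k != l) :
    uniq [:: i; j; k; l] ->
    dk_rel (LBr (dk_t ij) (dk_t kl)) LZero
| DK_4T (i j k : 'I_n.-1) (ij : i != j) (ik : i != k) (jk : j != k) :
    dk_rel (LBr (dk_t ij) (LAdd (dk_t ik) (dk_t jk))) LZero.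

Definition drinfeld_kohno (n : nat) : lieRingType := lie_pres (@dk_rel n).

(* [lex_gt lt u v] is u ≻ v; the empty word is the greatest element. *)
Fixpoint lex_gt (T : eqType) (lt : rel T) (u v : seq T) : bool :=
  match u, v with
  | [::], [::] => false
  | [::], _ :: _ => true
  | _ :: _, [::] => false
  | a :: u', b :: v' => lt b a || (a == b) && lex_gt lt u' v'
  end.

Definition deglex_gt (T : eqType) (lt : rel T) (u v : seq T) : bool :=
  (size v < size u)%N || (size u == size v) && lex_gt lt u v.

Definition alsw (T : eqType) (lt : rel T) (w : seq T) : bool :=
  (w != [::]) &&
  all (fun k => deglex_gt lt w (rot k w)) (iota 1 (size w).-1).

Lemma alswP (T : eqType) (lt : rel T) (w : seq T) :
  reflect (w <> [::] /\ forall u v, u <> [::] -> v <> [::] -> w = u ++ v ->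
             deglex_gt lt w (v ++ u))
          (alsw lt w).
Proof.
apply: (iffP andP) => -[/eqP w0 H]; split=> //.
  move=> u v u0 v0 wE; move/allP: H => /(_ (size u)).
  rewrite wE rot_size_cat mem_iota size_cat; apply.
  by case: u v u0 v0 {w0 wE} => [|a u] [|b v] //= _ _; rewrite addnS /= ltnS leq_addr.
apply/allP => k; rewrite mem_iota => /andP[k0 kw].
have {}kw : (k < size w)%N by case: w w0 kw {H}.
rewrite /rot; apply: H; last by rewrite cat_take_drop.
  by move/(congr1 size); rewrite size_takel ?(ltnW kw) //=; case: k k0 kw.
by move/(congr1 size)/eqP; rewrite size_drop /= subn_eq0 leqNgt kw.
Qed.

(* The least p >= 1 such that [drop p w] is an ALSW: for [size w >= 2],
   [drop p w] is the longest proper suffix of [w] that is an ALSW. *)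
Definition ls_split (T : eqType) (lt : rel T) (w : seq T) : nat :=
  (find (fun p => alsw lt (drop p w)) (iota 1 (size w).-1)).+1.

(* [k] is fuel; the recursive calls are on shorter words. *)
Fixpoint ls_bracket_rec (T : eqType) (lt : rel T) (L : lieRingType)
    (f : T -> L) (k : nat) (w : seq T) : L :=
  match k, w with
  | 0%N, _ | _, [::] => 0
  | _, [:: a] => f a
  | k'.+1, _ =>
      let p := ls_split lt w in
      lie (ls_bracket_rec lt f k' (take p w)) (ls_bracket_rec lt f k' (drop p w))
  end.

(* The image in [L] of the standard bracketing [w], each letter a being sent
   to [f a]. *)
Definition ls_bracket (T : eqType) (lt : rel T) (L : lieRingType) (f : T -> L)
  (w : seq T) : L := ls_bracket_rec lt f (size w) w.

Lemma ls_bracket1 (T : eqType) (lt : rel T) (L : lieRingType) (f : T -> L) a :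
  ls_bracket lt f [:: a] = f a.
Proof. by []. Qed.

Lemma ls_split_bounds (T : eqType) (lt : rel T) (w : seq T) :
  (1 < size w)%N -> (0 < ls_split lt w < size w)%N.
Proof.
case/lastP: w => // w a; rewrite size_rcons ltnS => w0; rewrite /ls_split /= ltnS.
rewrite size_rcons /= -[X in (_ < X)%N](size_iota 1) -has_find; apply/hasP.
exists (size w); first by rewrite mem_iota w0 add1n ltnS leqnn.
by rewrite -cats1 drop_size_cat.
Qed.

Lemma ls_bracket_recS (T : eqType) (lt : rel T) (L : lieRingType) (f : T -> L)
    (k : nat) (a b : T) (w : seq T) (s := [:: a, b & w]) (p := ls_split lt s) :
  ls_bracket_rec lt f k.+1 s =
  lie (ls_bracket_rec lt f k (take p s)) (ls_bracket_rec lt f k (drop p s)).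
Proof. by []. Qed.

Lemma ls_bracket_rec_fuel (T : eqType) (lt : rel T) (L : lieRingType)
    (f : T -> L) (k k' : nat) (w : seq T) :
  (size w <= k)%N -> (size w <= k')%N ->
  ls_bracket_rec lt f k w = ls_bracket_rec lt f k' w.
Proof.
elim: k k' w => [|k IH] [|k'] [|a [|b w]] // sk sk'.
have /andP[p0 ps] := @ls_split_bounds T lt [:: a, b & w] isT.
rewrite !ls_bracket_recS; move: (ls_split _ _) p0 ps => p p0 ps.
have st : (size (take p [:: a, b & w]) <= (size w).+1)%N.
  by rewrite size_takel ?(ltnW ps).
have sd : (size (drop p [:: a, b & w]) <= (size w).+1)%N.
  by rewrite size_drop leq_subLR /= -[(size w).+2]add1n leq_add2r.
by congr lie; apply: IH;
  first [exact: (leq_trans st sk) | exact: (leq_trans st sk')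
       | exact: (leq_trans sd sk) | exact: (leq_trans sd sk')].
Qed.

Lemma ls_bracket_split (T : eqType) (lt : rel T) (L : lieRingType) (f : T -> L)
    (w : seq T) : (1 < size w)%N ->
  ls_bracket lt f w = lie (ls_bracket lt f (take (ls_split lt w) w))
                          (ls_bracket lt f (drop (ls_split lt w) w)).
Proof.
case: w => [|a [|b w]] // w1; have /andP[p0 ps] := ls_split_bounds lt w1.
rewrite {1}/ls_bracket ls_bracket_recS; congr lie; apply: ls_bracket_rec_fuel => //.
  by rewrite size_takel ?(ltnW ps).
by rewrite size_drop leq_subLR /= -[(size w).+2]add1n leq_add2r.
Qed.

(* The recursion [w] = [[u][v]] with v the longest proper suffix of w = uv
   that is an ALSW. *)
Lemma ls_bracket_cat (T : eqType) (lt : rel T) (L : lieRingType) (f : T -> L)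
    (u v : seq T) :
  u <> [::] -> alsw lt v ->
  (forall u' v', u' <> [::] -> u ++ v = u' ++ v' -> alsw lt v' ->
     (size v' <= size v)%N) ->
  ls_bracket lt f (u ++ v) = lie (ls_bracket lt f u) (ls_bracket lt f v).
Proof.
move=> /eqP u0 av vmax; have /andP[v0 _] := av.
have su : (0 < size u)%N by rewrite lt0n size_eq0.
have sv : (0 < size v)%N by rewrite lt0n size_eq0.
have s1 : (1 < size (u ++ v))%N.
  by rewrite size_cat -[2%N]/(1 + 1)%N leq_add.
have pE : ls_split lt (u ++ v) = size u.
  rewrite /ls_split; set a := fun p => _; set r := iota _ _.
  have rE i : (i < size r)%N -> nth 0%N r i = i.+1.
    by rewrite size_iota => ir; rewrite nth_iota.
  have ur : ((size u).-1 < size r)%N.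
    by rewrite size_iota -ltnS !prednK ?(ltnW s1) // size_cat -addn1 leq_add2l.
  have au : a (nth 0%N r (size u).-1).
    by rewrite rE // prednK // /a drop_size_cat.
  have ra : has a r by apply/hasP; exists (nth 0%N r (size u).-1); rewrite ?mem_nth.
  apply/eqP; rewrite eqn_leq; apply/andP; split.
    rewrite -(prednK su) ltnS leqNgt; apply/negP => /(before_find 0%N).
    by rewrite au.
  have := nth_find 0%N ra; rewrite rE -?has_find // /a => af.
  have := vmax (take (find a r).+1 (u ++ v)) _ _ (esym (cat_take_drop _ _)) af.
  rewrite size_drop size_cat leq_subLR leq_add2r; apply.
  by case: (u ++ v) s1.
by rewrite ls_bracket_split // pE take_size_cat // drop_size_cat.
Qed.

(* t_ij for i < j *)
Definition dk_letter (n : nat) := {p : 'I_n.-1 * 'I_n.-1 | (p.1 < p.2)%N}.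

HB.instance Definition _ (n : nat) := Finite.on (dk_letter n).

Definition dk_lt (n : nat) : rel (dk_letter n) := fun a b =>
  ((val a).1 < (val b).1)%N ||
  ((val a).1 == (val b).1) && ((val a).2 < (val b).2)%N.

Lemma dk_letter_neq (n : nat) (a : dk_letter n) : (val a).1 != (val a).2.
Proof. by case: a => p /=; rewrite ltn_neqAle => /andP[]. Qed.

Definition dk_gen (n : nat) (a : dk_letter n) : drinfeld_kohno n :=
  lie_class (@dk_rel n) (dk_t (dk_letter_neq a)).

Definition dk_word (n : nat) (w : seq (dk_letter n)) : bool :=
  alsw (@dk_lt n) w && [exists i, all (fun a => (val a).1 == i) w].

Definition is_Zbasis (V : zmodType) (I : eqType) (b : I -> V) : Prop :=
  (forall (s : seq I) (c : I -> int), uniq s ->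
     \sum_(i <- s) b i *~ c i = 0 -> {in s, forall i, c i = 0})
  /\ (forall x : V, exists (s : seq I) (c : I -> int),
        uniq s /\ x = \sum_(i <- s) b i *~ c i).

(* Main.v *)
Require Import Defs.
From HB Require Import structures.
From mathcomp Require Import all_boot all_order all_algebra.
From mathcomp Require Import boolp functions ring.

(* L_n is the sum over i of the subrings S_i generated by the t_ij with j > i.
   By the 4T relations [t_kl, S_i] lies in S_i for i < k, so the sum of the S_i
   is a subring, hence everything, and each S_i is spanned by the standard
   bracketings of its Lyndon words by the usual rewriting argument.
   For independence, fix i and let t_ij act on noncommutative power series in
   letters x_j by left multiplication by x_j, let t_kl with i < k < l act as the
   derivation D_kl with D_kl x_k = [x_k, x_l] = - D_kl x_l (and zero on the
   other letters), and let t_kl with k < i act as 0.  Applying this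
   representation to the series 1 kills S_k for k <> i and sends the bracketing
   of a Lyndon word w over the t_ij to w plus words smaller than w. *)

Set Implicit Arguments.
Unset Strict Implicit.
Unset Printing Implicit Defensive.

Import GRing.Theory.
Local Open Scope ring_scope.

(** * Lyndon words *)

Definition strict_total (T : eqType) (lt : rel T) : Prop :=
  [/\ irreflexive lt, transitive lt & forall a b, a != b -> lt a b || lt b a].

Section LyndonWords.
Variables (T : eqType) (lt : rel T).
Hypothesis ltP : strict_total lt.

Local Notation "u ≺ v" := (lex_gt lt u v) (at level 70).
Local Notation lyndon := (alsw lt).

(* Since the empty word is the greatest one for [lex_gt], [u ≺ v] is the usual
   lexicographic order of dictionaries for the reversed order of letters. *)
Lemma lex_irr : irreflexive (lex_gt lt).
Proof. by have [irr _ _] := ltP; elim=> //= a u ->; rewrite irr andbF. Qed.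

Lemma lex_trans : transitive (lex_gt lt).
Proof.
have [_ tr _] := ltP; elim=> [|b v IH] [|a u] [|c w] //=.
case/orP=> [ba|/andP[/eqP-> uv]] /orP[cb|/andP[/eqP<- vw]].
- by rewrite (tr b).
- by rewrite ba.
- by rewrite cb.
- by rewrite eqxx (IH _ _ uv vw) orbT.
Qed.

Lemma lex_asym u v : u ≺ v -> ~~ (v ≺ u).
Proof. by move=> uv; apply/negP => /(lex_trans uv); rewrite lex_irr. Qed.

Lemma lex_total u v : u != v -> (u ≺ v) || (v ≺ u).
Proof.
have [_ _ tot] := ltP; elim: u v => [|a u IH] [|b v] //=.
rewrite eqseq_cons (eq_sym b a); case: eqVneq => /= [<- /IH|ab _].
  by case/orP=> ->; rewrite !orbT.
by rewrite !orbF orbC tot.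
Qed.

Lemma lexNge u v : ~~ (u ≺ v) -> v = u \/ v ≺ u.
Proof.
move=> uv; case: (eqVneq v u) => [|/lex_total/orP[]]; [by left|by right|].
by rewrite (negPf uv).
Qed.

Lemma lex_cat2l p u v : (p ++ u ≺ p ++ v) = (u ≺ v).
Proof. by have [irr _ _] := ltP; elim: p => //= a p ->; rewrite irr eqxx. Qed.

Lemma lex_prefix u v : v <> [::] -> u ≺ u ++ v.
Proof. by rewrite -{1}[u]cats0 lex_cat2l; case: v. Qed.

Lemma lex_prefixW w u v : w ≺ u -> w ≺ u ++ v.
Proof.
case: v => [|b v] wu; first by rewrite cats0.
exact: lex_trans wu (lex_prefix _ _).
Qed.

Lemma lex_cat u v : u ≺ v ->
  (exists2 t, t <> [::] & v = u ++ t) \/ (forall x y, u ++ x ≺ v ++ y).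
Proof.
elim: u v => [|a u IH] [|b v] //= => [_|]; first by left; exists (b :: v).
case/orP=> [ba|/andP[/eqP<- /IH[[t t0 ->]|uv]]].
- by right=> x y; rewrite ba.
- by left; exists t.
- by right=> x y; rewrite eqxx uv orbT.
Qed.

Lemma lex_cat_size u v x y : (size v <= size u)%N -> u ≺ v -> u ++ x ≺ v ++ y.
Proof.
move=> vu /lex_cat[[t t0 vE]|]; last exact.
move: vu; rewrite vE size_cat -{2}[size u]addn0 leq_add2l leqn0 size_eq0.
by case: t t0 {vE}.
Qed.

(** Rotations can be traded for proper suffixes. If w = uv satisfies w ≺ vu but not w ≺ v, then v is
    a prefix of w, say w = vt. Cancelling v gives t ≺ u, whence tv ≺ uv = w, against the rotation
    inequality w ≺ tv. *)
Lemma lyndonP w : reflect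
  (w <> [::] /\ forall u v, u <> [::] -> v <> [::] -> w = u ++ v -> w ≺ v)
  (lyndon w).
Proof.
apply: (iffP (alswP _ _)) => -[w0 H]; split=> // u v u0 v0 wE.
  have:= H _ _ u0 v0 wE; rewrite /deglex_gt wE !size_cat addnC ltnn eqxx /=.
  move=> wr; case: (boolP (u ++ v ≺ v)) => // /lexNge[/(congr1 size)/eqP|].
    rewrite size_cat -[X in X == _]add0n eqn_add2r eq_sym size_eq0.
    by move=> /eqP.
  move=> vw; have [[t t0 uvE]|/(_ u [::])] := lex_cat vw; last first.
    by rewrite cats0 => /(lex_trans wr); rewrite lex_irr.
  have suv : size t = size u.
    by apply/(@addnI (size v)); rewrite -size_cat -uvE size_cat addnC.
  have tu : t ≺ u by rewrite -(lex_cat2l v) -uvE.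
  have t0v : t <> [::] by [].
  have := H v t v0 t0; rewrite wE => /(_ uvE).
  rewrite /deglex_gt !size_cat suv ltnn eqxx /=.
  move=> /lex_trans/(_ (lex_cat_size v v _ tu)).
  by rewrite suv leqnn lex_irr; apply.
rewrite /deglex_gt wE !size_cat addnC eqxx /= -wE; apply/orP; right.
exact/lex_prefixW/(H u).
Qed.

Lemma lyndon1 a : lyndon [:: a].
Proof. by []. Qed.

Lemma lyndon_neq0 w : lyndon w -> w <> [::].
Proof. by case/lyndonP. Qed.

Lemma lyndon_suffix u v : u <> [::] -> v <> [::] -> lyndon (u ++ v) -> u ++ v ≺ v.
Proof. by move=> u0 v0 /lyndonP[_ /(_ u v)]; apply. Qed.

Lemma lyndon_suffixW u v : v <> [::] -> lyndon (u ++ v) ->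
  v = u ++ v \/ u ++ v ≺ v.
Proof.
by case: u => [|a u] v0 uv; [left|right; apply: lyndon_suffix].
Qed.

Lemma lyndon_cat_lt u v : lyndon u -> lyndon v -> u ≺ v -> u ++ v ≺ v.
Proof.
move=> /lyndon_neq0 u0 lv /lex_cat[[t t0 vE]|/(_ v [::])]; last by rewrite cats0.
by rewrite {2}vE lex_cat2l {1}vE; apply: lyndon_suffix; rewrite -?vE.
Qed.

(** Levi's lemma; the cases tell which of the two cuts comes first. *)
Lemma cat_eq_cat (x y u v : seq T) : x ++ y = u ++ v ->
  (exists t, x = u ++ t /\ v = t ++ y) \/
  (exists2 t, t <> [::] & u = x ++ t /\ y = t ++ v).
Proof.
elim: x u => [|a x IH] [|b u] /= => [->|->|<-|[<-]].
- by left; exists [::].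
- by right; exists (b :: u).
- by left; exists (a :: x).
- by case/IH=> [[t [-> ->]]|[t t0 [-> ->]]]; [left; exists t|right; exists t].
Qed.

(** A suffix contained in v is v or above v, hence above uv. A longer one is tv with t a proper
    suffix of u; as u ≺ t and t is not longer than u, they differ at a letter, which decides uv ≺
    tv. *)
Lemma lyndon_cat u v : lyndon u -> lyndon v -> u ≺ v -> lyndon (u ++ v).
Proof.
move=> lu lv uv; have uvv := lyndon_cat_lt lu lv uv.
apply/lyndonP; split=> [|x y x0 y0].
  by case: u lu {uv uvv} => // /lyndon_neq0.
case/cat_eq_cat=> [[t [uE ->]]|[t t0 [_ vE]]]; last first.
  apply: lex_trans uvv _; rewrite {1}vE; apply: lyndon_suffix => //.
  by rewrite -vE.
case: t uE => [|a t] uE; first exact: uvv.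
apply: lex_cat_size; first by rewrite uE size_cat leq_addl.
by rewrite {1}uE; apply: lyndon_suffix; rewrite -?uE.
Qed.

(** The standard factorisation of uv, phrased as in the hypotheses of [ls_bracket_cat]; [u' <> [::]]
    restricts to proper suffixes. *)
Definition longest_lyndon_suffix u v : Prop :=
  lyndon v /\
  forall u' v', u' <> [::] -> u ++ v = u' ++ v' -> lyndon v' ->
    (size v' <= size v)%N.

(** Induction on the length of s. Maximality of v keeps sv from being Lyndon. But if sv ≺ v, then sv
    is below all its proper suffixes: by induction for those longer than v, and because v is Lyndon
    for the others. *)
Lemma longest_lyndon_suffix_min u v t s : longest_lyndon_suffix u v ->
  u = t ++ s -> t <> [::] -> s <> [::] -> v ≺ s ++ v.
Proof.
case=> lv vmax.
elim: {s}(size s).+1 {-2}s t (ltnSn (size s)) => // k IH s t sk uE t0 s0.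
have nl : ~~ lyndon (s ++ v).
  apply/negP=> /(vmax t); rewrite uE catA => /(_ t0 erefl).
  by rewrite size_cat -[X in (_ <= X)%N]add0n leq_add2r leqn0 size_eq0 => /eqP.
have sv0 : s ++ v <> [::] by case: (s) s0.
case: (boolP (v ≺ s ++ v)) => // nv.
case/negP: nl; apply/lyndonP; split=> // x y x0 y0.
have sv : s ++ v ≺ v.
  case: (lexNge nv) => // /(congr1 size)/eqP.
  by rewrite size_cat -[X in _ == X]add0n eqn_add2r size_eq0 => /eqP.
case/cat_eq_cat=> [[r [sE ->]]|[r r0 [_ vE]]]; last first.
  apply: lex_trans sv _; rewrite {1}vE; apply: lyndon_suffix => //.
  by rewrite -vE.
case: (eqVneq r [::]) => [->//|/eqP r0].
apply: (lex_trans sv); apply: (IH r (t ++ x)) => //.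
- rewrite -ltnS; apply: leq_trans sk.
  by rewrite ltnS sE size_cat -add1n leq_add2r lt0n size_eq0; apply/eqP.
- by rewrite uE sE catA.
- by case: (t) t0.
Qed.

(** Let u = ts and suppose s ≺ u. A difference at a letter would give sv ≺ uv, so s is a prefix, u =
    sr. Cancelling s in uv ≺ sv leaves rv ≺ v, against the minimality of v. *)
Lemma longest_lyndon_suffix_prefix u v :
  longest_lyndon_suffix u v -> lyndon (u ++ v) -> u <> [::] -> lyndon u /\ u ≺ v.
Proof.
move=> luv uvl u0; have [lv _] := luv; have v0 := lyndon_neq0 lv.
have uvv := lyndon_suffix u0 v0 uvl.
split; last exact: lex_trans (lex_prefix _ v0) uvv.
apply/lyndonP; split=> // t s t0 s0 uE.
have vsv := longest_lyndon_suffix_min luv uE t0 s0.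
have sv0 : s ++ v <> [::] by case: (s) s0.
have uvsv : u ++ v ≺ s ++ v.
  rewrite {1}uE -catA; apply: lyndon_suffix => //.
  by rewrite catA -uE.
case: (boolP (u ≺ s)) => // /lexNge[/(congr1 size)/eqP|su].
  by rewrite uE size_cat -[X in X == _]add0n eqn_add2r eq_sym size_eq0 => /eqP.
have [[r r0 urE]|H] := lex_cat su; last first.
  by have := lex_asym (H v v); rewrite uvsv.
move: uvsv; rewrite urE -catA lex_cat2l => rvv.
have := lex_asym (longest_lyndon_suffix_min (s := r) luv urE s0 r0).
by rewrite rvv.
Qed.

Lemma longest_lyndon_suffixP w : lyndon w -> (1 < size w)%N ->
  exists u v, [/\ w = u ++ v, u <> [::] & longest_lyndon_suffix u v].
Proof.
move=> lw w1; pose a p := (0 < p < size w)%N && lyndon (drop p w).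
have exa : exists p, a p.
  (* The last letter alone is a Lyndon suffix, so a least cut exists. *)
  exists (size w).-1; case/lastP: w lw w1 @a => // w b _.
  rewrite size_rcons /= ltnS => w0 /=.
  by rewrite w0 ltnS leqnn -cats1 drop_size_cat //= lyndon1.
case: (ex_minnP exa) => p /andP[/andP[p0 pw] lp] pmin.
exists (take p w), (drop p w); rewrite cat_take_drop; split=> //.
  by move/(congr1 size); rewrite size_takel ?(ltnW pw) // => p1; rewrite p1 in p0.
split=> // u v u0; rewrite cat_take_drop => wE lv.
rewrite size_drop leq_subRL ?(ltnW pw) // wE size_cat leq_add2r; apply: pmin.
rewrite /a wE size_cat drop_size_cat // lv andbT lt0n size_eq0.
rewrite -[X in (X < _)%N]addn0 ltn_add2l lt0n size_eq0.
by rewrite (introN eqP u0) (introN eqP (lyndon_neq0 lv)).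
Qed.

(** Suppose tv is Lyndon for a nonempty proper suffix t of u. The second standard factor v' of u is
    t or below t by minimality, and v is not above v' by hypothesis; hence v ≺ tv, although tv ≺
    v. *)
Lemma longest_lyndon_suffix_cat u v : lyndon u -> lyndon v ->
  (forall u1 u2, u = u1 ++ u2 -> u1 <> [::] -> longest_lyndon_suffix u1 u2 ->
     ~~ (u2 ≺ v)) ->
  longest_lyndon_suffix u v.
Proof.
move=> lu lv H; split=> // x y x0.
case/cat_eq_cat=> [[t [uE yE]]|[t t0 [_ ->]]] ly; last by rewrite size_cat leq_addl.
case: (eqVneq t [::]) yE => [->->//|/eqP t0 yE]; exfalso.
have u1 : (1 < size u)%N.
  by rewrite uE size_cat -[2%N]/(1 + 1)%N leq_add // lt0n size_eq0; apply/eqP.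
have [u' [v' [uE' u'0 luv]]] := longest_lyndon_suffixP lu u1.
have v't : v' = t \/ v' ≺ t.
  have [lv' _] := luv.
  move: (uE'); rewrite uE => /cat_eq_cat[[r [_ v'E]]|[r r0 [u'E ->]]].
    have := lv'; rewrite v'E => /(lyndon_suffixW t0).
    by case=> [<-|]; [left|right].
  right; apply: longest_lyndon_suffix_min luv u'E x0 r0.
have tv : t ++ v ≺ v by apply: (lyndon_suffix t0 (lyndon_neq0 lv)); rewrite -yE.
have vt : v ≺ t ++ v.
  have vt : v = t \/ v ≺ t.
    case: (lexNge (H _ _ uE' u'0 luv)) => [->|vv']; first exact: v't.
    by right; case: v't => [<-//|]; apply: lex_trans.
  by case: vt => [{1}->|/lex_prefixW]; [exact/lex_prefix/lyndon_neq0|exact].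
by have := lex_asym tv; rewrite vt.
Qed.
End LyndonWords.

(** * Spanning by Lyndon brackets *)

Section LieRingTheory.
Variable L : lieRingType.
Implicit Types x y z : L.

Lemma lie0x x : lie 0 x = 0.
Proof. by apply: (addIr (lie 0 x)); rewrite -lieDl !add0r. Qed.

Lemma liex0 x : lie x 0 = 0.
Proof. by apply: (addIr (lie x 0)); rewrite -lieDr !add0r. Qed.

Lemma lieNx x y : lie (- x) y = - lie x y.
Proof. by apply/eqP; rewrite -addr_eq0 -lieDl addNr lie0x. Qed.

Lemma liexN x y : lie x (- y) = - lie x y.
Proof. by apply/eqP; rewrite -addr_eq0 -lieDr addNr liex0. Qed.

Lemma lieC x y : lie x y = - lie y x.
Proof.
apply/eqP; rewrite -addr_eq0; apply/eqP.
by have := liexx (x + y); rewrite lieDl !lieDr !liexx add0r addr0.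
Qed.

Lemma lie_der x y z : lie x (lie y z) = lie (lie x y) z + lie y (lie x z).
Proof.
apply/eqP; rewrite -subr_eq0 -(lie_jacobi x y z) opprD addrA addrAC.
by rewrite (lieC z x) liexN (lieC z) -!addrA [- _ - _]addrC.
Qed.

Lemma lie_lie x y z : lie (lie x y) z = lie (lie x z) y + lie x (lie y z).
Proof. by rewrite (lie_der x y z) (lieC y) addrCA addrN addr0. Qed.

End LieRingTheory.

Section Span.
Variable V : zmodType.

Inductive Zspan (B : V -> Prop) : V -> Prop :=
| Zspan0 : Zspan B 0
| ZspanB x y : Zspan B x -> Zspan B y -> Zspan B (x - y)
| Zspan_gen x : B x -> Zspan B x.

Lemma ZspanN B x : Zspan B x -> Zspan B (- x).
Proof. by rewrite -[- x]add0r; apply/ZspanB/Zspan0. Qed.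

Lemma ZspanD B x y : Zspan B x -> Zspan B y -> Zspan B (x + y).
Proof. by move=> Bx /ZspanN By; rewrite -[y]opprK; apply: ZspanB. Qed.

Lemma Zspan_sub (B C : V -> Prop) x :
  (forall y, B y -> Zspan C y) -> Zspan B x -> Zspan C x.
Proof.
move=> BC; elim=> [|y z _ Cy _ Cz|y /BC//]; first exact: Zspan0.
exact: ZspanB.
Qed.

Lemma Zspan_sum (I : eqType) (b : I -> V) x :
  Zspan (fun y => exists i, y = b i) x ->
  exists (s : seq I) (c : I -> int), uniq s /\ x = \sum_(i <- s) b i *~ c i.
Proof.
suff: Zspan (fun y => exists i, y = b i) x ->
    exists l : seq (I * int), x = \sum_(p <- l) b p.1 *~ p.2.
  (* An index may occur several times in [l]; its coefficient collects all the occurrences. *)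
  move=> H /H[l ->]; exists (undup (map fst l)).
  exists (fun i => \sum_(p <- l | p.1 == i) p.2); split; first exact: undup_uniq.
  under [RHS]eq_bigr => i _ do rewrite mulrz_sumr big_mkcond.
  rewrite exchange_big big_seq [RHS]big_seq; apply: eq_bigr => -[i m] il /=.
  rewrite -big_mkcond /= (eq_bigl (fun j => j == i)) => [|j]; last exact: eq_sym.
  rewrite -big_filter filter_pred1_uniq ?undup_uniq ?big_seq1 //.
  by rewrite mem_undup; apply/mapP; exists (i, m).
elim=> [|y z _ [ly ->] _ [lz ->]|y [i ->]].
- by exists [::]; rewrite big_nil.
- exists (ly ++ map (fun p => (p.1, - p.2)) lz).
  rewrite big_cat big_map -sumrN /=; congr (_ + _).
  by apply: eq_bigr => p _; rewrite mulrNz.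
- by exists [:: (i, 1)]; rewrite big_seq1.
Qed.

End Span.

Lemma Zspan_biadditive (U V W : zmodType) (op : U -> V -> W)
    (B : U -> Prop) (C : V -> Prop) (D : W -> Prop) x y :
  (forall x x' y, op (x - x') y = op x y - op x' y) ->
  (forall x y y', op x (y - y') = op x y - op x y') ->
  (forall x y, B x -> C y -> Zspan D (op x y)) ->
  Zspan B x -> Zspan C y -> Zspan D (op x y).
Proof.
move=> opBl opBr BCD Bx Cy; elim: Bx => {x} [|x x' _ Dx _ Dx'|x Bx].
- by rewrite -[X in op X y](subrr 0) opBl subrr; apply: Zspan0.
- by rewrite opBl; apply: ZspanB.
elim: Cy => {y} [|y y' _ Dy _ Dy'|y Cy].
- by rewrite -[X in op x X](subrr 0) opBr subrr; apply: Zspan0.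
- by rewrite opBr; apply: ZspanB.
- exact: BCD.
Qed.

Lemma Zspan_lie (L : lieRingType) (B C D : L -> Prop) x y :
  (forall x y, B x -> C y -> Zspan D (lie x y)) ->
  Zspan B x -> Zspan C y -> Zspan D (lie x y).
Proof.
by apply: Zspan_biadditive => *; rewrite (lieDl, lieDr) (lieNx, liexN).
Qed.

Lemma Zspan_mul (R : pzRingType) (B C D : R -> Prop) x y :
  (forall x y, B x -> C y -> Zspan D (x * y)) ->
  Zspan B x -> Zspan C y -> Zspan D (x * y).
Proof. by apply: Zspan_biadditive => *; rewrite (mulrBl, mulrBr). Qed.

Lemma ls_bracket_longest (T : eqType) (lt : rel T) (L : lieRingType)
    (f : T -> L) u v : u <> [::] -> longest_lyndon_suffix lt u v ->
  ls_bracket lt f (u ++ v) = lie (ls_bracket lt f u) (ls_bracket lt f v).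
Proof. by move=> u0 [lv vmax]; apply: ls_bracket_cat. Qed.

Section LyndonSpan.
Variables (T : finType) (lt : rel T).
Hypothesis ltP : strict_total lt.
Variables (L : lieRingType) (f : T -> L) (P : pred T).

Local Notation "u ≺ v" := (lex_gt lt u v) (at level 70).
Local Notation lyndon := (alsw lt).
Local Notation "⟦ w ⟧" := (ls_bracket lt f w).

Definition lyndon_brackets (x : L) : Prop :=
  exists w, [/\ lyndon w, all P w & x = ⟦ w ⟧ ].

Definition lyndon_brackets_below N v (x : L) : Prop :=
  exists w, [/\ lyndon w, all P w, size w = N, w ≺ v & x = ⟦ w ⟧ ].

Lemma lyndon_brackets_belowW N v v' x : v ≺ v' ->
  Zspan (lyndon_brackets_below N v) x -> Zspan (lyndon_brackets_below N v') x.
Proof.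
move=> vv'; apply: Zspan_sub => y [w [lw Pw wN wv ->]].
by apply: Zspan_gen; exists w; split=> //; apply: lex_trans wv vv'.
Qed.

(** Only finitely many words have length at most N, so counting those below v gives a measure that
    drops with v. *)
Let rank N v := #|[pred t : N.-bseq T | (t : seq T) ≺ v]|.

Let rank_lt N v v' : (size v <= N)%N -> v ≺ v' -> (rank N v < rank N v')%N.
Proof.
move=> vN vv'; apply/proper_card/properP; split.
  by apply/subsetP=> t; rewrite !inE => tv; apply: lex_trans tv vv'.
by exists (Bseq vN); rewrite !inE ?lex_irr.
Qed.

(* Jacobi step of the induction: if u = u1 u2 with u2 ≺ v, then
   [[u1 u2] v] = [[u1 v] u2] + [u1 [u2 v]] and both outer brackets expand in
   Lyndon words below v, so that the larger of the two words decreases. *)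
Lemma lie_lyndon_below u v : lyndon u -> lyndon v -> all P u -> all P v ->
  u ≺ v ->
  Zspan (lyndon_brackets_below (size u + size v) v) (lie ⟦ u ⟧ ⟦ v ⟧).
Proof.
(* The outer induction, on total length, treats the inner brackets [u1 v] and [u2 v]; the inner
   induction, on [rank], treats the outer brackets. *)
elim: {u v}(size u + size v)%N {-2}u {-2}v (leqnn (size u + size v)) => [|n IHn] u v.
  move=> + lu; have := lyndon_neq0 ltP lu.
  by case: (u).
elim: {v}(rank n.+1 v).+1 {-2}v u (ltnSn (rank n.+1 v)) => // k IHk v u.
rewrite ltnS => vk uvn lu lv Pu Pv uv.
case: (pselect (exists u1 u2, [/\ u = u1 ++ u2, u1 <> [::],
    longest_lyndon_suffix lt u1 u2 & u2 ≺ v])) => [|H]; last first.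
  (* Here (u, v) is the standard factorisation of the Lyndon word uv, so nothing is left to
     rewrite. *)
  have luv : longest_lyndon_suffix lt u v.
    apply: longest_lyndon_suffix_cat => // u1 u2 uE u10 lu12.
    by apply/negP=> u2v; apply: H; exists u1, u2.
  rewrite -ls_bracket_longest //; last exact: lyndon_neq0 lu.
  apply: Zspan_gen; exists (u ++ v); rewrite all_cat Pu Pv size_cat; split=> //.
    exact: lyndon_cat.
  exact: lyndon_cat_lt.
case=> u1 [u2 [uE u10 lu12 u2v]].
have below w w' : (size w + size w' = size u + size v)%N ->
  lyndon w -> lyndon w' -> all P w -> all P w' -> w ≺ v -> w' ≺ v ->
  Zspan (lyndon_brackets_below (size u + size v) v) (lie ⟦ w ⟧ ⟦ w' ⟧).
  wlog ww' : w w' / w ≺ w' => [hw|] ww'E lw lw' Pw Pw' wv w'v.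
    case: (boolP (w ≺ w')) => [|/(lexNge ltP)[->|]]; first by move=> /hw; apply.
      by rewrite liexx; apply: Zspan0.
    by rewrite lieC => w'w; apply/ZspanN/hw; rewrite // addnC.
  apply: (lyndon_brackets_belowW w'v); rewrite -ww'E; apply: IHk => //.
  - apply: leq_trans vk; apply: rank_lt; rewrite // -?ww'E.
    by apply: leq_trans uvn; rewrite -ww'E leq_addl.
  - by rewrite ww'E.
have [lu1 u1u2] : lyndon u1 /\ u1 ≺ u2.
  by apply: longest_lyndon_suffix_prefix => //; rewrite -uE.
have [lu2 _] := lu12; have u20 := lyndon_neq0 ltP lu2.
have u1v : u1 ≺ v by apply: lex_trans uv; rewrite // uE; apply: lex_prefix.
move: Pu; rewrite {1}uE all_cat => /andP[Pu1 Pu2].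
have s1 : (0 < size u1)%N by rewrite lt0n size_eq0; apply/eqP.
have s2 : (0 < size u2)%N by rewrite lt0n size_eq0; apply/eqP.
have su : size u = (size u1 + size u2)%N by rewrite uE size_cat.
rewrite {2}uE ls_bracket_longest // lie_lie; apply: ZspanD.
  apply: (@Zspan_lie _ (lyndon_brackets_below (size u1 + size v) v) (eq ⟦ u2 ⟧)).
  - move=> _ _ [w [lw Pw wN wv ->]] <-; apply: below => //.
    by rewrite wN su addnAC.
  - apply: IHn => //; rewrite -ltnS; apply: leq_trans uvn.
    by rewrite su -addnA ltn_add2l -[X in (X < _)%N]add0n ltn_add2r.
  - exact: Zspan_gen.
apply: (@Zspan_lie _ (eq ⟦ u1 ⟧) (lyndon_brackets_below (size u2 + size v) v)).
- move=> _ _ <- [w [lw Pw wN wv ->]]; apply: below => //.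
  by rewrite wN su addnA.
- exact: Zspan_gen.
- apply: IHn => //; rewrite -ltnS; apply: leq_trans uvn.
  by rewrite su -addnA -[X in (X < _)%N]add0n ltn_add2r.
Qed.

Lemma Zspan_lyndon_lie x y : Zspan lyndon_brackets x ->
  Zspan lyndon_brackets y -> Zspan lyndon_brackets (lie x y).
Proof.
apply: Zspan_lie => {x y} _ _ [u [lu Pu ->]] [v [lv Pv ->]].
wlog uv : u v lu Pu lv Pv / u ≺ v => [hw|].
  case: (boolP (u ≺ v)) => [|/(lexNge ltP)[->|]]; first exact: hw.
    by rewrite liexx; apply: Zspan0.
  by rewrite lieC => vu; apply/ZspanN/hw.
apply: Zspan_sub (lie_lyndon_below lu lv Pu Pv uv) => _ [w [lw Pw _ _ ->]].
by apply: Zspan_gen; exists w.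
Qed.

Lemma Zspan_lyndon_letter a : P a -> Zspan lyndon_brackets (f a).
Proof. by move=> Pa; apply: Zspan_gen; exists [:: a]; rewrite /= Pa. Qed.

End LyndonSpan.

(** * Leading monomials of Lyndon brackets *)

(** [Q 0] covers the empty word, whose bracketing is 0 by convention. *)
Lemma ls_bracket_ind (T : eqType) (lt : rel T) (L : lieRingType) (f : T -> L)
    (Q : L -> Prop) w :
  Q 0 -> {in w, forall a, Q (f a)} ->
  (forall x y, Q x -> Q y -> Q (lie x y)) -> Q (ls_bracket lt f w).
Proof.
move=> Q0 + Qlie; elim: {w}(size w).+1 {-2}w (ltnSn (size w)) => // k IH w.
rewrite ltnS => wk Qf; case: (ltnP 1 (size w)) => w1.
  have /andP[p0 pw] := ls_split_bounds lt w1.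
  rewrite ls_bracket_split //; apply: Qlie; apply: IH.
  - by rewrite size_takel ?(ltnW pw) // (leq_trans pw).
  - by move=> a /mem_take; apply: Qf.
  - apply: leq_trans wk; rewrite size_drop.
    by rewrite ltn_subrL p0 (ltn_trans _ w1).
  - by move=> a /mem_drop; apply: Qf.
case: w w1 Qf {wk} => [|a [|b w]] //= _ Qf; apply: Qf; exact: mem_head.
Qed.

Lemma lie_morph0 (L M : lieRingType) (h : L -> M) : is_lie_morphism h -> h 0 = 0.
Proof. by case=> hD _; apply: (addIr (h 0)); rewrite -hD !add0r. Qed.

Lemma lie_morphN (L M : lieRingType) (h : L -> M) x :
  is_lie_morphism h -> h (- x) = - h x.
Proof.
by move=> hh; apply/eqP; rewrite -addr_eq0 -(lie_morphD hh) addNr lie_morph0.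
Qed.

Lemma lie_morph_bracket (T : eqType) (lt : rel T) (L M : lieRingType)
    (h : L -> M) (f : T -> L) w : is_lie_morphism h ->
  h (ls_bracket lt f w) = ls_bracket lt (fun a => h (f a)) w.
Proof.
move=> hh; elim: {w}(size w).+1 {-2}w (ltnSn (size w)) => // k IH w.
rewrite ltnS => wk; case: (ltnP 1 (size w)) => w1.
  have /andP[p0 pw] := ls_split_bounds lt w1.
  rewrite ls_bracket_split // [RHS]ls_bracket_split // (lie_morph_lie hh) !IH //.
    apply: leq_trans wk; rewrite size_drop.
    by rewrite ltn_subrL p0 (ltn_trans _ w1).
  by rewrite size_takel ?(ltnW pw) // (leq_trans pw).
by case: w w1 {wk} => [|a [|b w]] //= _; rewrite /ls_bracket /= lie_morph0.
Qed.

(** An alias, so that the commutator bracket is not attached to [R] itself. *)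
Definition commutator_ring (R : pzRingType) : Type := R.
HB.instance Definition _ (R : pzRingType) := GRing.PzRing.on (commutator_ring R).

Section Commutator.
Variable R : pzRingType.
Let C := commutator_ring R.
Let br (x y : C) : C := x * y - y * x.

Let brDl x y z : br (x + y) z = br x z + br y z.
Proof. by rewrite /br mulrDl mulrDr opprD addrACA. Qed.

Let brDr x y z : br x (y + z) = br x y + br x z.
Proof. by rewrite /br mulrDl mulrDr opprD addrACA. Qed.

Let brxx x : br x x = 0.
Proof. exact: subrr. Qed.

Let br_jacobi x y z : br x (br y z) + br y (br z x) + br z (br x y) = 0.
Proof.
(* Grouped as positive minus negative monomials, the three Jacobi terms telescope. *)
have E (a b c d : C) : a - b - (c - d) = (a + d) - (b + c).
  by rewrite opprB addrACA -opprD.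
rewrite /br !(mulrBl, mulrBr) !mulrA !E (addrC (y * z * x)) (addrC (y * x * z)).
by rewrite (addrC (z * y * x)) !subrKA subrr.
Qed.

HB.instance Definition _ :=
  Zmodule_isLieRing.Build (commutator_ring R) brDl brDr brxx br_jacobi.
End Commutator.

Lemma lie_commE (R : pzRingType) (x y : commutator_ring R) :
  lie x y = x * y - y * x.
Proof. by []. Qed.

Section LeadingTerm.
Variables (T : eqType) (lt : rel T).
Hypothesis ltP : strict_total lt.
Variables (R : pzRingType) (X : T -> commutator_ring R).

Local Notation "u ≺ v" := (lex_gt lt u v) (at level 70).
Local Notation monomial u := (\prod_(a <- u) X a).

Let monomials_from w (x : R) :=
  exists u, [/\ perm_eq u w, u = w \/ w ≺ u & x = monomial u].

(** Let w = uv be the standard factorisation, U = [u], V = [v]. In UV every monomial but uv is above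
    uv, and each monomial of VU begins with v or a word above v, so is above v and hence above uv.
    The [perm_eq] condition fixes lengths, so that comparisons of factors survive concatenation. *)
Lemma ls_bracket_leading w : alsw lt w ->
  Zspan (fun x => exists u, [/\ perm_eq u w, w ≺ u & x = monomial u])
    (ls_bracket lt X w - monomial w).
Proof.
elim: {w}(size w).+1 {-2}w (ltnSn (size w)) => // k IH w.
rewrite ltnS => wk lw; case: (ltnP 1 (size w)) => [w1|]; last first.
  case: w lw {wk} => [|a [|b w]] //= _ _.
  by rewrite big_seq1 ls_bracket1 subrr; apply: Zspan0.
have from w' : (size w' < size w)%N -> alsw lt w' ->
    Zspan (monomials_from w') (ls_bracket lt X w').
  move=> w'w lw'; rewrite -[X in Zspan _ X](subrK (monomial w')).
  apply: ZspanD; last by apply: Zspan_gen; exists w'; split=> //; left.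
  apply: Zspan_sub (IH _ (leq_trans w'w wk) lw') => _ [u [pu w'u ->]].
  by apply: Zspan_gen; exists u; split=> //; right.
have [u [v [wE u0 luv]]] := longest_lyndon_suffixP ltP lw w1.
have luvw : alsw lt (u ++ v) by rewrite -wE.
have [lu _] := longest_lyndon_suffix_prefix ltP luv luvw u0.
have [lv _] := luv; have v0 := lyndon_neq0 ltP lv.
have uvv : u ++ v ≺ v by apply: lyndon_suffix.
have su : (size u < size w)%N.
  by rewrite wE size_cat -[X in (X < _)%N]addn0 ltn_add2l lt0n size_eq0; apply/eqP.
have sv : (size v < size w)%N.
  by rewrite wE size_cat -[X in (X < _)%N]add0n ltn_add2r lt0n size_eq0; apply/eqP.
rewrite wE ls_bracket_longest // lie_commE big_cat /=.
set U := ls_bracket lt X u; set V := ls_bracket lt X v.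
(* Splits the error into that of U, that of V, and the product VU. *)
have -> : U * V - V * U - monomial u * monomial v =
   (U - monomial u) * V + monomial u * (V - monomial v) - V * U.
  by rewrite mulrBl mulrBr addrA subrK addrAC.
have sE (x y : seq T) : perm_eq x y -> size x = size y by move/perm_size.
apply: ZspanB; first apply: ZspanD.
- apply: (Zspan_mul _ (IH _ (leq_trans su wk) lu) (from _ sv lv)).
  move=> _ _ [u' [pu uu' ->]] [v' [pv vv' ->]]; apply: Zspan_gen.
  exists (u' ++ v'); rewrite big_cat perm_cat //; split=> //.
  by apply: lex_cat_size; rewrite ?(sE _ _ pu).
- apply: (@Zspan_mul _ (eq (monomial u)) _ _ _ _ _ _ (IH _ (leq_trans sv wk) lv)).
    move=> _ _ <- [v' [pv vv' ->]]; apply: Zspan_gen.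
    by exists (u ++ v'); rewrite big_cat perm_cat2l lex_cat2l.
  exact: Zspan_gen.
apply: (Zspan_mul _ (from _ sv lv) (from _ su lu)).
move=> _ _ [v' [pv vv' ->]] [u' [pu uu' ->]]; apply: Zspan_gen.
exists (v' ++ u'); rewrite big_cat perm_catC perm_cat //; split=> //.
apply: (lex_trans ltP uvv).
case: vv' => [->|vv']; last exact: lex_prefixW.
apply: (lex_prefix ltP) => u'0; apply: u0; apply/size0nil.
by rewrite -(sE _ _ pu) u'0.
Qed.

End LeadingTerm.

(** * Operators on noncommutative power series *)

Record zend (U : zmodType) := Zend {
  zend_fun :> U -> U;
  zend_funB : forall f g, zend_fun (f - g) = zend_fun f - zend_fun g
}.

HB.instance Definition _ (U : zmodType) := gen_eqMixin (zend U).
HB.instance Definition _ (U : zmodType) := gen_choiceMixin (zend U).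

Section EndomorphismRing.
Variable U : zmodType.
Implicit Types X Y Z : zend U.

Lemma zendP X Y : X =1 Y -> X = Y.
Proof.
case: X Y => [x xB] [y yB] /= /funext xy; move: yB; rewrite -xy => yB.
by rewrite (Prop_irrelevance xB yB).
Qed.

HB.instance Definition _ X := GRing.isZmodMorphism.Build U U X (zend_funB X).

Let addB X Y : zmod_morphism (fun f => X f + Y f).
Proof. by move=> f g; rewrite !raddfB opprD addrACA. Qed.
Let oppB X : zmod_morphism (fun f => - X f).
Proof. by move=> f g; rewrite raddfB opprD. Qed.
Let mulB X Y : zmod_morphism (fun f => X (Y f)).
Proof. by move=> f g; rewrite !raddfB. Qed.
Let zeroB : zmod_morphism (fun _ : U => 0 : U).
Proof. by move=> f g; rewrite subr0. Qed.
Let oneB : zmod_morphism (fun f : U => f).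
Proof. by []. Qed.

Definition zend_add X Y := Zend (addB X Y).
Definition zend_opp X := Zend (oppB X).
Definition zend_mul X Y := Zend (mulB X Y).
Definition zend_zero := Zend zeroB.
Definition zend_one := Zend oneB.

Lemma zend_addA : associative zend_add.
Proof. by move=> X Y Z; apply: zendP => f /=; rewrite addrA. Qed.
Lemma zend_addC : commutative zend_add.
Proof. by move=> X Y; apply: zendP => f /=; rewrite addrC. Qed.
Lemma zend_add0 : left_id zend_zero zend_add.
Proof. by move=> X; apply: zendP => f /=; rewrite add0r. Qed.
Lemma zend_addN : left_inverse zend_zero zend_opp zend_add.
Proof. by move=> X; apply: zendP => f /=; rewrite addNr. Qed.

HB.instance Definition _ := GRing.isZmodule.Build (zend U)
  zend_addA zend_addC zend_add0 zend_addN.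

Lemma zend_mulA : associative zend_mul.
Proof. by move=> X Y Z; apply: zendP. Qed.
Lemma zend_mul1 : left_id zend_one zend_mul.
Proof. by move=> X; apply: zendP. Qed.
Lemma zend_mulr1 : right_id zend_one zend_mul.
Proof. by move=> X; apply: zendP. Qed.
Lemma zend_mulDl : left_distributive zend_mul +%R.
Proof. by move=> X Y Z; apply: zendP. Qed.
Lemma zend_mulDr : right_distributive zend_mul +%R.
Proof. by move=> X Y Z; apply: zendP => f /=; rewrite raddfD. Qed.

HB.instance Definition _ := GRing.Zmodule_isPzRing.Build (zend U)
  zend_mulA zend_mul1 zend_mulr1 zend_mulDl zend_mulDr.

End EndomorphismRing.

Lemma mulrzfctE (T : Type) (V : zmodType) (f : T -> V) (m : int) :
  f *~ m = (fun x => f x *~ m).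
Proof. by case: m => m; rewrite /intmul natmulfctE. Qed.

Section WordSeries.
Variable J : finType.

Local Notation series := (seq J -> int).
Local Notation gl := (commutator_ring (zend series)).
Implicit Types (f g : series) (a b c d y : J).

Lemma gl_lieE (X Y : gl) f : (lie X Y : gl) f = X (Y f) - Y (X f).
Proof. by []. Qed.

(** The monomial u; in particular [delta [::]] is the series 1. *)
Definition delta (u : seq J) : series := fun v => (v == u)%:R.

(** Left multiplication by the variable x_y, read on coefficients. *)
Definition lmul_fun y f : series :=
  fun w => if w is z :: w' then if z == y then f w' else 0 else 0.

Let lmul_funB y : zmod_morphism (lmul_fun y).
Proof.
move=> f g; apply/funext=> -[|z w]; rewrite /lmul_fun !fctE ?subr0 //.
by case: eqP; rewrite ?subr0.
Qed.

Definition lmul y : gl := Zend (lmul_funB y).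

(* Writing f = f(1) + sum_y y f_y with f_y v = f (y :: v), the Leibniz rule reads
   D f = sum_y y (D f_y) + (a b - b a) (f_a - f_b). *)
Fixpoint der_fun a b f (w : seq J) : int :=
  if w isn't z :: w' then 0 else
  der_fun a b (fun v => f (z :: v)) w' +
  (if w' isn't z' :: w'' then 0 else
   (((z == a) && (z' == b))%:R - ((z == b) && (z' == a))%:R) *
   (f (a :: w'') - f (b :: w''))).

Let der_funB a b : zmod_morphism (der_fun a b).
Proof.
move=> f g; apply/funext=> w; rewrite !fctE.
elim: w f g => [|z w IH] f g /=; first by rewrite subr0.
rewrite -[fun v => (f - g) _]/((fun v => f (z :: v)) - (fun v => g (z :: v))).
rewrite IH; case: w {IH} => [|z' w]; first by rewrite !addr0.
ring.
Qed.

Definition der a b : gl := Zend (der_funB a b).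

(** Swapping a and b changes the sign of both ab - ba and f_a - f_b. *)
Lemma der_sym a b : der a b = der b a.
Proof.
apply: zendP => f; apply/funext=> w /=; elim: w f => //= z w IH f.
by rewrite IH; case: w {IH} => // z' w; congr (_ + _); ring.
Qed.

Lemma der_delta_nil a b : der a b (delta [::]) = 0.
Proof.
apply/funext=> -[|z w] //=; rewrite /delta /=.
rewrite -[X in der_fun _ _ X]/(0 : series) -[der_fun _ _]/(der a b : _ -> _) raddf0.
by rewrite add0r; case: w => // *; rewrite subrr mulr0.
Qed.

Lemma lmul_delta y u : lmul y (delta u) = delta (y :: u).
Proof.
apply/funext=> -[|z w] //=; rewrite /delta eqseq_cons.
by case: eqP.
Qed.

Lemma prod_lmul_delta (T : eqType) (g : T -> J) (u : seq T) :
  (\prod_(a <- u) lmul (g a) : zend series) (delta [::]) = delta (map g u).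
Proof.
elim: u => [|a u IH]; first by rewrite big_nil.
by rewrite big_cons /= -lmul_delta -IH.
Qed.

(** The Leibniz rule for operators: [D, x_y] is left multiplication by D x_y. The scalar merges the
    cases y = a, y = b and neither. *)
Lemma lie_der_lmulE a b y f w : (lie (der a b) (lmul y) : gl) f w =
  ((y == a)%:R - (y == b)%:R) * (lie (lmul a) (lmul b) : gl) f w.
Proof.
rewrite !gl_lieE !fctE; case: w => [|z w] /=; first by rewrite subrr mulr0.
have -> : der_fun a b (fun v => if z == y then f v else 0) w =
    if z == y then der_fun a b f w else 0.
  case: eqP => // _; rewrite -[fun _ => 0]/(0 : series).
  by rewrite -[der_fun _ _]/(der a b : _ -> _) raddf0.
(* The recursive terms cancel and only the Leibniz correction remains. *)
rewrite (addrC (if _ then _ else _)) addrK.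
case: w => [|z' w] /=; first by rewrite !if_same subrr mulr0.
rewrite (eq_sym a y) (eq_sym b y).
by do 6![case: (_ == _)] => /=; ring.
Qed.

Lemma lie_der_lmul a b : a != b ->
  lie (der a b) (lmul a) = lie (lmul a) (lmul b).
Proof.
move=> /negPf ab; apply: zendP => f; apply/funext=> w.
by rewrite lie_der_lmulE eqxx ab subr0 mul1r.
Qed.

Lemma lie_der_lmul0 a b y : y != a -> y != b -> lie (der a b) (lmul y) = 0.
Proof.
move=> /negPf ya /negPf yb; apply: zendP => f; apply/funext=> w.
by rewrite lie_der_lmulE ya yb subrr mul0r.
Qed.

(** Writing f = f(1) + sum_y x_y f_y, the hypotheses give X f = sum_y x_y (X f_y). So the
    coefficient of X f at z :: w is that of X f_z at w, and induction on the word concludes. *)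
Lemma gl_eq0 (X : gl) :
  X (delta [::]) = 0 -> (forall y, lie X (lmul y) = 0) -> X = 0.
Proof.
move=> X1 Xl; apply: zendP => f; apply/funext=> w; rewrite [RHS]/=.
have Xlf y g : X (lmul y g) = lmul y (X g).
  apply/eqP; rewrite -subr_eq0 -gl_lieE Xl; exact/eqP.
have fE g : g = delta [::] *~ g [::] + \sum_y lmul y (fun v => g (y :: v)).
  apply/funext=> -[|z v]; rewrite fctE fct_sumE mulrzfctE /=.
    by rewrite big1_eq addr0 intz.
  by rewrite mul0rz add0r -big_mkcond (big_pred1 z) // => y; rewrite /= eq_sym.
have XE g : X g = \sum_y lmul y (X (fun v => g (y :: v))).
  rewrite {1}(fE g) raddfD raddfMz /= X1 mul0rz add0r raddf_sum.
  by apply: eq_bigr => y _; apply: Xlf.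
elim: w f => [|z w IH] f; rewrite XE fct_sumE big1 // => y _ /=.
by rewrite IH; apply: if_same.
Qed.
End WordSeries.

Section DerivationRelations.
Variable J : finType.
Local Notation gl := (commutator_ring (zend (seq J -> int))).
Local Notation x := (@lmul J).
Local Notation D := (@der J).
Implicit Types a b c d y : J.

Lemma lie_delta_nil0 (X Y : gl) : X (delta [::]) = 0 -> Y (delta [::]) = 0 ->
  (lie X Y : gl) (delta [::]) = 0.
Proof. by move=> X1 Y1; rewrite gl_lieE X1 Y1 !raddf0 subrr. Qed.

Lemma lie_der_lmulr a b : a != b -> lie (D a b) (x b) = lie (x b) (x a).
Proof. by move=> ab; rewrite der_sym lie_der_lmul // eq_sym. Qed.

(** By [gl_eq0] it suffices to bracket with each x_y. The value of D_cd on a letter involves only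
    x_c and x_d, which D_ab kills, and conversely. *)
Lemma der_comm a b c d : uniq [:: a; b; c; d] -> lie (D a b) (D c d) = 0.
Proof.
rewrite /= !inE !negb_or andbT => /andP[/and3P[ab ac ad] /andP[/andP[bc bd] cd]].
have H p q r s y : p != r -> p != s -> q != r -> q != s -> r != s ->
    lie (D p q) (lie (D r s) (x y)) = 0.
  move=> pr ps qr qs rs.
  have Dr : lie (D p q) (x r) = 0 by rewrite lie_der_lmul0 // eq_sym.
  have Ds : lie (D p q) (x s) = 0 by rewrite lie_der_lmul0 // eq_sym.
  case: (eqVneq y r) => [->|yr].
    by rewrite lie_der_lmul // lie_der Dr Ds lie0x liex0 addr0.
  case: (eqVneq y s) => [->|ys].
    by rewrite lie_der_lmulr // lie_der Dr Ds lie0x liex0 addr0.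
  by rewrite (lie_der_lmul0 yr ys) liex0.
apply: gl_eq0 => [|y]; first by apply: lie_delta_nil0; apply: der_delta_nil.
by rewrite lie_lie lieC !H ?oppr0 ?addr0 // eq_sym.
Qed.

Lemma der_4T a b c : a != b -> a != c -> b != c ->
  lie (D a b) (D a c + D b c) = 0.
Proof.
move=> ab ac bc; apply: gl_eq0 => [|y].
  apply: lie_delta_nil0; first exact: der_delta_nil.
  rewrite -[LHS]/(D a c (delta _) + D b c (delta _)).
  by rewrite !der_delta_nil addr0.
(* The letters a and b are exchanged by D_ab = D_ba, so one computation serves both; it ends in the
   Jacobi identity for x_p, x_q, x_c. *)
have H p q : p != q -> p != c -> q != c ->
    lie (lie (D p q) (D p c + D q c)) (x p) = 0.
  move=> pq pc qc; set P := D p q; set Q := _ + _.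
  have Pp : lie P (x p) = lie (x p) (x q) by exact: lie_der_lmul.
  have Pc : lie P (x c) = 0 by rewrite lie_der_lmul0 // eq_sym.
  have Qp : lie Q (x p) = lie (x p) (x c).
    by rewrite lieDl lie_der_lmul // lie_der_lmul0 // addr0.
  have Qq : lie Q (x q) = lie (x q) (x c).
    by rewrite lieDl (lie_der_lmul qc) lie_der_lmul0 ?add0r // eq_sym.
  rewrite lie_lie Pp Qp (lieC _ Q) (lie_der Q) (lie_der P) Pp Pc Qp Qq liex0 addr0.
  by rewrite -lie_lie addNr.
case: (eqVneq y a) => [->|ya]; first exact: H.
case: (eqVneq y b) => [->|yb].
  by rewrite der_sym (addrC (D a c)) H // eq_sym.
rewrite lie_lie (lie_der_lmul0 ya yb) lie0x add0r lieDl.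
case: (eqVneq y c) => [->|yc]; last by rewrite !lie_der_lmul0 // addr0 liex0.
(* The letter c: D_ac + D_bc sends x_c to [x_c, x_a + x_b], and D_ab kills both x_c and x_a +
   x_b. *)
rewrite !lie_der_lmulr // lieDr !(lie_der (D a b)) lie_der_lmul // lie_der_lmulr //.
rewrite lie_der_lmul0 1?eq_sym // !lie0x !add0r.
by rewrite (lieC (x b)) liexN addrN.
Qed.

End DerivationRelations.

(** * The action of the generators for a fixed first index i *)

Section Representation.
Variables (m : nat) (i : 'I_m).
Local Notation gl := (commutator_ring (zend (seq 'I_m -> int))).
Implicit Types j k l : 'I_m.

Definition dk_act j k : gl :=
  if (j < i)%N || (k < i)%N then 0 else
  if j == i then lmul k else if k == i then lmul j else der j k.

Lemma dk_act_sym j k : j != k -> dk_act j k = dk_act k j.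
Proof.
move=> jk; rewrite /dk_act orbC; case: ifP => // _.
case: (eqVneq j i) (eqVneq k i) jk => [->|_] [->|_] //.
by rewrite der_sym.
Qed.

(** At most one of the two pairs contains i, so two left multiplications never meet; and a
    derivation D commutes with multiplication by a letter that it kills. *)
Lemma dk_act_comm j k l p : uniq [:: j; k; l; p] ->
  lie (dk_act j k) (dk_act l p) = 0.
Proof.
move=> U; have := U.
rewrite /= !inE !negb_or andbT => /andP[/and3P[jk jl jp] /andP[/andP[kl kp] lp]].
rewrite /dk_act; case: (_ || _); first by rewrite lie0x.
case: (_ || _); first by rewrite liex0.
case: (eqVneq j i) jk jl jp => [->|_] jk jl jp.
  rewrite !(eq_sym _ i) (negPf jl) (negPf jp).
  by rewrite lieC lie_der_lmul0 ?oppr0.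
case: (eqVneq k i) kl kp jk => [->|_] kl kp jk.
  rewrite !(eq_sym _ i) (negPf kl) (negPf kp).
  by rewrite lieC lie_der_lmul0 ?oppr0.
case: (eqVneq l i) => _; first by rewrite lie_der_lmul0 // eq_sym.
case: (eqVneq p i) => _; first by rewrite lie_der_lmul0 // eq_sym.
exact: der_comm.
Qed.

(** If no index is below i and one equals i, the relation reads [x_k, x_l + D_kl] = 0,
    [x_j, D_jl + x_l] = 0 or [D_jk, x_j + x_k] = 0; these restate the values of D on letters. *)
Lemma dk_act_4T j k l : j != k -> j != l -> k != l ->
  lie (dk_act j k) (dk_act j l + dk_act k l) = 0.
Proof.
move=> jk jl kl; rewrite /dk_act.
case: (ltnP j i) => /= _; first by rewrite lie0x.
case: (ltnP k i) => /= _; first by rewrite lie0x.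
case: (ltnP l i) => /= _; first by rewrite addr0 liex0.
case: (eqVneq j i) jk jl => [->|ji] jk jl.
  rewrite !(eq_sym _ i) (negPf jk) (negPf jl).
  by rewrite lieDr (lieC _ (der k l)) lie_der_lmul // addrN.
case: (eqVneq k i) jk kl => [->|ki] jk kl.
  rewrite !(eq_sym _ i) (negPf kl).
  by rewrite lieDr (lieC _ (der j l)) lie_der_lmul // addNr.
case: (eqVneq l i) => _; last exact: der_4T.
by rewrite lieDr lie_der_lmul // lie_der_lmulr // (lieC (lmul k)) addrN.
Qed.

End Representation.

(** * The Drinfeld-Kohno Lie ring *)

Lemma exists_minimal (I : eqType) (r : rel I) (s : seq I) :
  irreflexive r -> transitive r -> s != [::] ->
  exists2 m, m \in s & {in s, forall i, ~~ r i m}.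
Proof.
move=> irr tr; elim: s => // a [_ _|b s IH _].
  by exists a => [|i]; rewrite inE // => /eqP->; rewrite irr.
have [m ms mmin] := IH isT; case: (boolP (r a m)) => am.
  exists a => [|i]; first exact: mem_head.
  rewrite inE => /orP[/eqP->|/mmin/negP im]; first by rewrite irr.
  by apply/negP => /tr/(_ am).
exists m => [|i]; first by rewrite inE ms orbT.
by rewrite inE => /orP[/eqP->|/mmin].
Qed.

(** Among the indices with nonzero coefficient take an [r]-minimal m; then [phi m] sends the sum to
    [c m]. *)
Lemma triangular_free (V : zmodType) (I : eqType) (b : I -> V) (r : rel I)
    (phi : I -> {additive V -> int}) :
  irreflexive r -> transitive r ->
  (forall i j, ~~ r i j -> phi j (b i) = (i == j)%:R) ->
  forall (s : seq I) (c : I -> int), uniq s ->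
    \sum_(i <- s) b i *~ c i = 0 -> {in s, forall i, c i = 0}.
Proof.
move=> irr tr phib s c us sum0 i si; apply/eqP; apply: contraT => ci.
have t0 : [seq j <- s | c j != 0] != [::].
  apply/eqP => t0; have := mem_filter (fun j => c j != 0) i s.
  by rewrite t0 ci si.
have [m] := exists_minimal irr tr t0.
rewrite mem_filter => /andP[cm ms] mmin.
have := congr1 (phi m) sum0; rewrite raddf0 raddf_sum (big_rem m) //= big_seq.
rewrite big1 => [|j].
  by rewrite raddfMz phib ?irr // eqxx addr0 intz => c0; rewrite c0 eqxx in cm.
rewrite mem_rem_uniq // inE => /andP[jm js].
case: (eqVneq (c j) 0) => [->|cj]; first by rewrite mulr0z raddf0.
by rewrite raddfMz phib ?(negPf jm) ?mul0rz // mmin // mem_filter cj.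
Qed.

Section DrinfeldKohno.
Variable n : nat.

Local Notation L := (drinfeld_kohno n).
Local Notation J := 'I_n.-1.
Local Notation gl := (commutator_ring (zend (seq J -> int))).
Local Notation letter := (dk_letter n).
Local Notation lt := (@dk_lt n).
Local Notation "⟦ w ⟧" := (ls_bracket lt (@dk_gen n) w).
Implicit Types (i j k l : J) (a b : letter) (w u : seq letter).

Lemma dk_lt_strict_total : strict_total lt.
Proof.
split=> [a|b a c|a b]; rewrite /dk_lt.
- by rewrite !ltnn andbF.
- case/orP=> [ab|/andP[/eqP-> ab]] /orP[bc|/andP[/eqP<- bc]].
  + by rewrite (ltn_trans ab).
  + by rewrite ab.
  + by rewrite bc.
  + by rewrite eqxx (ltn_trans ab) ?orbT.
rewrite -val_eqE -pair_eqE /pair_eq negb_and.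
case: (ltngtP (val a).1 (val b).1) => //= [ab|]; first by rewrite orbT.
move/val_inj=> ->; rewrite eqxx /= => ab.
by rewrite -neq_ltn.
Qed.

(** * Coordinate functionals from the representations *)

Lemma dk_rep i : exists h : L -> gl,
  is_lie_morphism h /\
  forall a, h (dk_gen a) = dk_act i (val a).1 (val a).2.
Proof.
have [|h [hh hg _]] := @lie_pres_universal _ (@dk_rel n)
    (commutator_ring (zend (seq J -> int)))
    (fun p : dk_pair n => dk_act i (val p).1 (val p).2).
  move=> s t; case=> {s t} /=.
  - by move=> j k jk kj; apply: dk_act_sym.
  - by move=> j k l p jk lp; apply: dk_act_comm.
  - by move=> j k l jk jl kl; apply: dk_act_4T.
by exists h; split=> // a; apply: hg.
Qed.

Lemma dk_snd_inj i w u :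
  all (fun a => (val a).1 == i) w -> all (fun a => (val a).1 == i) u ->
  map (fun a => (val a).2) w = map (fun a => (val a).2) u -> w = u.
Proof.
elim: w u => [|a w IH] [|b u] //= /andP[/eqP ai wi] /andP[/eqP bi ui] [ab wu].
congr (_ :: _); last exact: IH.
by apply/val_inj; rewrite [LHS]surjective_pairing [RHS]surjective_pairing ai bi ab.
Qed.

(** With i the first index of w0, the functional takes x to the coefficient, in the series x acting
    on 1, of the word of second indices of w0. *)
Lemma dk_coordinate (w0 : seq letter) : dk_word w0 ->
  exists phi : {additive L -> int}, forall w, dk_word w ->
    ~~ lex_gt lt w w0 -> phi ⟦ w ⟧ = (w == w0)%:R.
Proof.
case/andP=> lw0 /existsP[i w0i]; have [h [hh hg]] := dk_rep i.
have phiB : zmod_morphism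
    (fun x : L => h x (delta [::]) (map (fun a => (val a).2) w0)).
  by move=> x y; rewrite (lie_morphD hh) lie_morphN.
pose phi : {additive L -> int} :=
  HB.pack (fun x : L => h x (delta [::]) (map (fun a => (val a).2) w0))
    (GRing.isZmodMorphism.Build _ _ _ phiB).
exists phi => w /andP[lw /existsP[k wk]] ww0; rewrite /phi /= lie_morph_bracket //.
case: (eqVneq k i) wk => [->|ki] wk; last first.
  set X := ls_bracket _ _ _.
  have -> : X (delta [::]) = 0.
    pose Q (Y : gl) := Y (delta [::]) = 0.
    apply: (@ls_bracket_ind _ _ _ _ Q) => [//|a aw|Y Z].
      have ak := eqP (allP wk _ aw); have aP := valP a.
      rewrite /Q hg /dk_act; case: ifP => // /norP[].
      rewrite -!leqNgt => ia ia'; rewrite ak (negPf ki).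
      (* A second index equal to i would force k < i, excluded here; so the letter acts as a
         derivation and kills 1. *)
      case: eqVneq => [ai|_]; last exact: der_delta_nil.
      move: aP ia; rewrite ai ak => ki'; rewrite leqNgt ki' //.
    exact: lie_delta_nil0.
  case: eqP => // ww; move: w0i; rewrite -ww.
  by case: w wk lw {X ww0 ww} => //= a w /andP[/eqP-> _] _; rewrite (negPf ki).
(* A rearrangement of w keeps first index i, so it acts by left multiplications and turns 1 into its
   word of second indices. *)
have monomialE u : perm_eq u w ->
    (\prod_(a <- u) h (dk_gen a) : zend _) (delta [::])
      (map (fun a => (val a).2) w0) = (u == w0)%:R.
  move=> uw; have ui : all (fun a => (val a).1 == i) u by rewrite (perm_all _ uw).
  rewrite (eq_big_seq (fun a => lmul (val a).2)) => [|a au]; last first.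
    have ai := eqP (allP ui _ au); have aP := valP a.
    by rewrite hg /dk_act -ai ltnn ltnNge (ltnW aP) /= eqxx.
  rewrite prod_lmul_delta /delta; congr (_%:R); apply: congr1.
  by apply/eqP/eqP=> [/(dk_snd_inj w0i ui)|->].
set X := ls_bracket _ _ _; set M := \prod_(a <- w) h (dk_gen a).
have := ls_bracket_leading dk_lt_strict_total (fun a => h (dk_gen a)) lw.
rewrite -/X -/M => XM; rewrite -[X](subrK M).
set Y := X - M in XM *; rewrite -[LHS]/(Y _ _ + M _ _) monomialE //.
suff -> : Y (delta [::]) (map (fun a => (val a).2) w0) = 0 by rewrite add0r.
elim: XM => [//|Z Z' _ Z0 _ Z'0|_ [u [uw wu ->]]].
  by rewrite -[LHS]/(Z _ _ - Z' _ _) Z0 Z'0 subrr.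
(* A term equal to w0 would give [lex_gt lt w w0], against the hypothesis. *)
rewrite monomialE //; case: eqP => // u0.
by rewrite -u0 wu in ww0.
Qed.

(** * Spanning by the subrings S_i *)

Definition dk_cls i j (ij : i != j) : L := lie_class (@dk_rel n) (dk_t ij).

Lemma dk_cls_sym i j (ij : i != j) (ji : j != i) : dk_cls ij = dk_cls ji.
Proof. by apply/lie_classP/LC_rel/DK_sym. Qed.

Lemma dk_cls_comm i j k l (ij : i != j) (kl : k != l) :
  uniq [:: i; j; k; l] -> lie (dk_cls ij) (dk_cls kl) = 0.
Proof.
by move=> U; rewrite [lie _ _]lp_brE; apply/lie_classP/LC_rel/DK_comm.
Qed.

Lemma dk_cls_4T i j k (ij : i != j) (ik : i != k) (jk : j != k) :
  lie (dk_cls ij) (dk_cls ik + dk_cls jk) = 0.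
Proof.
by rewrite [_ + _]lp_addE [lie _ _]lp_brE; apply/lie_classP/LC_rel/DK_4T.
Qed.

Lemma dk_cls_lie i j k (ij : i != j) (ik : i != k) (jk : j != k) :
  lie (dk_cls jk) (dk_cls ij) = lie (dk_cls ij) (dk_cls ik).
Proof.
by apply/eqP; rewrite lieC eq_sym -addr_eq0 -lieDr dk_cls_4T.
Qed.

(** The subring S_i, described by its spanning brackets so that closure under [lie] is the rewriting
    argument. *)
Definition dk_span i :=
  Zspan (lyndon_brackets lt (@dk_gen n) (fun a => (val a).1 == i)).

Lemma dk_span_lie i x y : dk_span i x -> dk_span i y -> dk_span i (lie x y).
Proof. exact: (Zspan_lyndon_lie dk_lt_strict_total). Qed.

Lemma dk_cls_genE i j (ij : (i < j)%N) (ne : i != j) :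
  dk_cls ne = dk_gen (exist (fun p : J * J => (p.1 < p.2)%N) (i, j) ij).
Proof.
rewrite /dk_cls /dk_gen; congr (lie_class _ (dk_t _)); exact: bool_irrelevance.
Qed.

Lemma dk_cls_span i j (ij : i != j) : (i < j)%N -> dk_span i (dk_cls ij).
Proof. by move=> lij; rewrite (dk_cls_genE lij); apply: Zspan_lyndon_letter => /=. Qed.

(** For i < k < l, the bracket [t_kl, t_ij] equals [t_ij, t_il] if j = k, [t_ij, t_ik] if j = l, and
    0 otherwise. *)
Lemma dk_span_gen_gen i a b : (val b).1 = i -> (i < (val a).1)%N ->
  dk_span i (lie (dk_gen a) (dk_gen b)).
Proof.
case: a b => -[k l] /= kl [[i' j] /= ij] /= <- ik {i}; rename i' into i.
have il := ltn_trans ik kl.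
have neq (p q : J) : (p < q)%N -> p != q by move=> /ltn_eqF/negbT.
have [[nkl nij] [nik nil]] := ((neq _ _ kl, neq _ _ ij), (neq _ _ ik, neq _ _ il)).
rewrite -(dk_cls_genE kl nkl) -(dk_cls_genE ij nij).
case: (eqVneq j k) ij nij => [->|jk] ij nij.
  rewrite (dk_cls_lie nij nil nkl).
  by apply: dk_span_lie; apply: dk_cls_span.
have nlk : l != k by rewrite eq_sym.
case: (eqVneq j l) ij nij => [->|jl] ij nij.
  rewrite (dk_cls_sym nkl nlk) (dk_cls_lie nij nik nlk).
  by apply: dk_span_lie; apply: dk_cls_span.
rewrite dk_cls_comm; first exact: Zspan0.
rewrite /= !inE !negb_or nkl nij (eq_sym k i) (eq_sym l i) nik nil.
by rewrite !(eq_sym _ j) jk jl.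
Qed.

Lemma dk_span_gen_lie i a x : (i < (val a).1)%N -> dk_span i x ->
  dk_span i (lie (dk_gen a) x).
Proof.
move=> ia; apply: (@Zspan_lie _ (eq (dk_gen a))); last exact: Zspan_gen.
move=> _ _ <- [w [_ wi ->]].
suff [] : dk_span i ⟦ w ⟧ /\ dk_span i (lie (dk_gen a) ⟦ w ⟧) by [].
(* Membership is carried along because [t, [y, z]] = [[t, y], z] + [y, [t, z]] also involves y and z
   themselves. *)
pose Q y := dk_span i y /\ dk_span i (lie (dk_gen a) y).
apply: (@ls_bracket_ind _ _ _ _ Q) => [|b bw|y z [Sy Say] [Sz Saz]].
- by rewrite /Q liex0; split; apply: Zspan0.
- have bi := allP wi _ bw; split; first exact: Zspan_lyndon_letter.
  by apply: dk_span_gen_gen => //; apply/eqP.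
- split; first exact: dk_span_lie.
  by rewrite lie_der; apply: ZspanD; apply: dk_span_lie.
Qed.

Lemma dk_span_ideal i k x y : (i < k)%N -> dk_span k y -> dk_span i x ->
  dk_span i (lie y x).
Proof.
move=> ik Sy Sx; apply: (@Zspan_lie _ _ (eq x)) Sy _; last exact: Zspan_gen.
move=> _ _ [w [_ wk ->]] <- {y}.
(* Quantifying over x allows [[y, z], x] to be treated as two successive actions. *)
pose Q y := forall x, dk_span i x -> dk_span i (lie y x).
move: x Sx; apply: (@ls_bracket_ind _ _ _ _ Q).
- by move=> x _; rewrite lie0x; apply: Zspan0.
- by move=> a aw x; apply: dk_span_gen_lie; rewrite (eqP (allP wk _ aw)).
move=> y z Hy Hz x Sx; rewrite lie_lie; apply: ZspanD; last exact/Hy/Hz.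
by rewrite lieC; apply/ZspanN/Hz/Hy.
Qed.

Definition dk_brackets (x : L) : Prop :=
  exists w : {w : seq letter | dk_word w}, x = ⟦ val w ⟧.

Lemma dk_span_brackets i x : dk_span i x -> Zspan dk_brackets x.
Proof.
apply: Zspan_sub => _ [w [lw wi ->]]; apply: Zspan_gen.
have dw : dk_word w by rewrite /dk_word lw; apply/existsP; exists i.
by exists (exist _ w dw).
Qed.

(** A bracket of S_i with S_k falls into the one with the smaller index. *)
Lemma dk_brackets_lie x y : Zspan dk_brackets x -> Zspan dk_brackets y ->
  Zspan dk_brackets (lie x y).
Proof.
apply: Zspan_lie => {x y} _ _ [[u du] ->] [[v dv] ->] /=.
have spanP w : dk_word w -> exists i, dk_span i ⟦ w ⟧.
  case/andP=> lw /existsP[i wi]; exists i; apply: Zspan_gen.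
  by exists w.
have [[i Su] [k Sv]] := (spanP _ du, spanP _ dv).
case: (ltngtP i k) => [ik|ki|/val_inj ik].
- by rewrite lieC; apply/ZspanN/(@dk_span_brackets i)/(dk_span_ideal ik).
- exact/(@dk_span_brackets k)/(dk_span_ideal ki).
- by apply: (@dk_span_brackets i); apply: dk_span_lie; rewrite // ik.
Qed.

Lemma dk_brackets_cls i j (ij : i != j) : Zspan dk_brackets (dk_cls ij).
Proof.
case: (ltngtP i j) => [lij|lji|/val_inj ij']; last by case/eqP: (ij).
  exact/(@dk_span_brackets i)/dk_cls_span.
have ji : j != i by rewrite eq_sym.
by rewrite (dk_cls_sym ij ji); apply/(@dk_span_brackets j)/dk_cls_span.
Qed.

Lemma dk_brackets_span (x : L) : Zspan dk_brackets x.
Proof.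
rewrite -(lie_class_repr x).
elim: (repr x) => {x} [[[i j] ij]||s IHs|s IHs t IHt|s IHs t IHt].
- exact: dk_brackets_cls.
- exact: Zspan0.
- by rewrite -lp_oppE; apply: ZspanN.
- by rewrite -lp_addE; apply: ZspanD.
- by rewrite -lp_brE; apply: dk_brackets_lie.
Qed.

End DrinfeldKohno.

Theorem corollary4p3 (n : nat) (hn : (2 < n)%N) :
  is_Zbasis (fun w : {w : seq (dk_letter n) | dk_word w} =>
               ls_bracket (@dk_lt n) (@dk_gen n) (val w)).
Proof.
split=> [|x]; last exact/Zspan_sum/dk_brackets_span.
have /choice[phi phiP] (w0 : {w : seq (dk_letter n) | dk_word w}) :
    exists phi : {additive drinfeld_kohno n -> int},
      forall w : {w : seq (dk_letter n) | dk_word w},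
        ~~ lex_gt (@dk_lt n) (val w) (val w0) ->
        phi (ls_bracket (@dk_lt n) (@dk_gen n) (val w)) = (w == w0)%:R.
  have [phi phiP] := dk_coordinate (valP w0).
  by exists phi => w /phiP->; last exact: valP.
(* The coordinate at w0 is controlled except on words w with [lex_gt] of w over w0, so the system is
   triangular for this order. *)
pose r (u v : {w : seq (dk_letter n) | dk_word w}) :=
  lex_gt (@dk_lt n) (val u) (val v).
apply: (triangular_free (phi := phi) (r := r)).
- by move=> w; apply: lex_irr (dk_lt_strict_total n) _.
- by move=> v u w; apply: lex_trans (dk_lt_strict_total n) _ _ _.
- by move=> w w0; apply: phiP.
Qed.
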